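(* For every $\alpha\in\tilde R^\times$, $$\ell_{\Pi_0}(w_\alpha)=|\mathrm{ht}(\alpha)|.$$ In particular, if $\alpha=\sum_{i=0}^\nu n_i\alpha_i$ (with $n_i\in\mathbb{Z}$ and $\Pi_0=\{\alpha_0,\dots,\alpha_\nu\}$), then $\ell_{\Pi_0}(w_\alpha)=\sum_{i=0}^\nu|n_i|$.
   Context: Let $A$ be a free abelian group of rank $\nu+1$ with a symmetric positive semidefinite bi-additive form $(\cdot,\cdot):A\times A\to\mathbb{Q}$ whose radical is $\Lambda=\{\alpha:(\alpha,A)=0\}$; let $\{\epsilon,\sigma_1,\dots,\sigma_\nu\}$ be a $\mathbb{Z}$-basis of $A$ with $\{\sigma_1,\dots,\sigma_\nu\}$ a $\mathbb{Z}$-basis of $\Lambda$ and $(\epsilon,\epsilon)=2$. Let $\tilde R=\{k\epsilon+\sigma:k\in\{0,\pm1\},\sigma\in\Lambda\}$ and $\tilde R^\times=\pm\epsilon+\Lambda$. For $\alpha\in\tilde R^\times$, $w_\alpha\in\mathrm{Aut}(A)$ is $w_\alpha(\beta)=\beta-\frac{2(\beta,\alpha)}{(\alpha,\alpha)}\alpha$, and $\mathcal{W}=\langle w_\alpha:\alpha\in\tilde R^\times\rangle$. For $\sigma=\sum_{i=1}^\nu m_i\sigma_i\in\Lambda$ put $m^+=\sum_{m_i>0}m_i$, $m^-=\sum_{m_i<0}m_i$, and $\mathrm{ht}_{\mathfrak{B}^0}(\sigma)=2m^+$ if $m^+\ge|m^-|$, $=2m^-$ if $m^+<|m^-|$. For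 $\alpha=k\epsilon+\sigma\in\tilde R$, $\mathrm{ht}(\alpha)=k-\mathrm{ht}_{\mathfrak{B}^0}(\sigma)$ if $k=-1$ and $m^+=|m^-|$, and $\mathrm{ht}(\alpha)=k+\mathrm{ht}_{\mathfrak{B}^0}(\sigma)$ otherwise. The fundamental root basis is $\Pi_0=\{\alpha_0=\epsilon,\ \alpha_1=\sigma_1-\epsilon,\dots,\alpha_\nu=\sigma_\nu-\epsilon\}$, a $\mathbb{Z}$-basis of $A$; the reflections $w_{\alpha_0},\dots,w_{\alpha_\nu}$ generate $\mathcal{W}$. For $w\in\mathcal{W}$, $\ell_{\Pi_0}(w)$ is the smallest $k\ge0$ such that $w=w_{\beta_1}\cdots w_{\beta_k}$ with all $\beta_j\in\Pi_0$ ($\ell_{\Pi_0}(1)=0$). *)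

(* Defs.v *)
From mathcomp Require Import all_boot all_order all_algebra.
From mathcomp Require Import boolp classical_sets.

Set Implicit Arguments.
Unset Strict Implicit.
Unset Printing Implicit Defensive.

Import Order.TTheory GRing.Theory Num.Theory.

Local Open Scope ring_scope.

Definition lincomb (A : zmodType) (n : nat) (b : 'I_n -> A)
    (m : {ffun 'I_n -> int}) : A := \sum_(i < n) b i *~ m i.

(* [S] is meant to be a subgroup of [A]; uniqueness of the coefficients is
   then linear independence over the integers. *)
Definition Zbasis (A : zmodType) (n : nat) (b : 'I_n -> A) (S : A -> Prop) :
    Prop :=
  (forall i, S (b i)) /\
  (forall x, S x -> exists! m : {ffun 'I_n -> int}, x = lincomb b m).

(* The junk value 0 is returned only when [x] is not a combination of [b]. *)
Definition coord (A : zmodType) (n : nat) (b : 'I_n -> A) (x : A) :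
    {ffun 'I_n -> int} :=
  xget [ffun _ => 0] [set m | x = lincomb b m]%classic.

(* The family (x, b_0, ..., b_{n-1}). *)
Definition fcons (A : Type) (n : nat) (x : A) (b : 'I_n -> A) : 'I_n.+1 -> A :=
  fun i => if unlift ord0 i is Some j then b j else x.

Definition biadditive (A : zmodType) (form : A -> A -> rat) : Prop :=
  (forall x y z, form (x + y) z = form x z + form y z) /\
  (forall x y z, form x (y + z) = form x y + form x z).

Definition radical (A : zmodType) (form : A -> A -> rat) (x : A) : Prop :=
  forall y, form x y = 0.

Definition Rtimes (A : zmodType) (form : A -> A -> rat) (eps : A) (x : A) :
    Prop :=
  exists2 s, radical form s & x = eps + s \/ x = - eps + s.

(* The floor only serves to read the rational number 2(b,a)/(a,a) as an
   integer: it is one for every a in [Rtimes], see [reflE] below. *)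
Definition refl (A : zmodType) (form : A -> A -> rat) (a b : A) : A :=
  b - a *~ Num.floor (2%:R * form b a / form a a).

Definition word (A : zmodType) (form : A -> A -> rat) (n : nat)
    (P : 'I_n -> A) (s : seq 'I_n) : A -> A :=
  foldr (fun i f => refl form (P i) \o f) id s.

(* "w lies in the group generated by the reflections in the family [P], and
   its length with respect to [P] is k"; automorphisms are compared
   pointwise. *)
Definition has_length (A : zmodType) (form : A -> A -> rat) (n : nat)
    (P : 'I_n -> A) (w : A -> A) (k : nat) : Prop :=
  (exists2 s : seq 'I_n, size s = k & w =1 word form P s) /\
  (forall s : seq 'I_n, w =1 word form P s -> (k <= size s)%N).

Definition mplus (n : nat) (m : 'I_n -> int) : int := \sum_(i < n | 0 < m i) m i.

Definition mminus (n : nat) (m : 'I_n -> int) : int :=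
  \sum_(i < n | m i < 0) m i.

Definition ht0 (n : nat) (m : 'I_n -> int) : int :=
  if `|mminus m| <= mplus m then 2 * mplus m else 2 * mminus m.

Definition ht (A : zmodType) (nu : nat) (eps : A) (sig : 'I_nu -> A) (x : A) :
    int :=
  let c := coord (fcons eps sig) x in
  let k := c ord0 in
  let m := fun i : 'I_nu => c (lift ord0 i) in
  if (k == -1) && (mplus m == `|mminus m|) then k - ht0 m else k + ht0 m.

Definition Pi0 (A : zmodType) (nu : nat) (eps : A) (sig : 'I_nu -> A) :
    'I_nu.+1 -> A :=
  fcons eps (fun i => sig i - eps).

Lemma reflE (A : zmodType) (nu : nat) (form : A -> A -> rat) (eps : A)
    (sig : 'I_nu -> A) (a b : A) :
  biadditive form -> (forall x y, form x y = form y x) ->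
  Zbasis sig (radical form) -> Zbasis (fcons eps sig) (fun _ => True) ->
  form eps eps = 2%:R -> Rtimes form eps a ->
  exists2 z : int, z%:~R = 2%:R * form b a / form a a
                 & refl form a b = b - a *~ z.
Proof.
move=> [DL DR] sym [rad _] [_ gen] ee ha.
have Z0 y : form 0 y = 0 by apply: (addrI (form 0 y)); rewrite -DL !addr0.
have NL x y : form (- x) y = - form x y.
  by apply: (addrI (form x y)); rewrite -DL !subrr Z0.
have Zn x y n : form (x *+ n) y = form x y *+ n.
  by elim: n => [|n IH]; rewrite ?mulr0n ?Z0 // !mulrS DL IH.
have ZZ x y (z : int) : form (x *~ z) y = form x y *~ z.
  by case: z => n; rewrite ?NegzE ?mulrNz ?NL ?(Zn _ _ n) ?(Zn _ _ n.+1).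
have aE y : form a y = form eps y \/ form a y = - form eps y.
  by case: ha => s rs [] ->; rewrite DL (rs y) addr0 ?NL; [left | right].
have aa : form a a = 2%:R.
  by case: ha => s rs [] ->; rewrite DL rs addr0 ?NL sym DL rs addr0 ?NL ?opprK.
have [z be] : exists z : int, form eps b = z%:~R * 2%:R.
  have [m [-> _]] := gen b I; exists (m ord0).
  rewrite sym /lincomb big_ord_recl DL {1}/fcons unlift_none ZZ ee.
  rewrite (big_morph (form^~ eps) (fun x y => DL x y eps) (Z0 eps)) big1 => [|i _].
    by rewrite addr0 -mulrzr mulrC.
  by rewrite /fcons liftK ZZ (rad i) mul0rz.
suff [t tE] : exists t : int, t%:~R = 2%:R * form b a / form a a.
  by exists t => //; rewrite /refl -tE intrKfloor.
rewrite aa mulrAC divff // mul1r sym.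
case: (aE b) => ->; rewrite be; first by exists (z * 2); rewrite intrM.
by exists (- (z * 2)); rewrite mulrNz intrM.
Qed.

(* Main.v *)
Require Import Defs.
From mathcomp Require Import all_boot all_order all_algebra.
From HB Require Import structures.
From mathcomp Require Import classical_sets zify ring.

Set Implicit Arguments.
Unset Strict Implicit.
Unset Printing Implicit Defensive.

Import Order.TTheory GRing.Theory Num.Theory.

Local Open Scope ring_scope.

(** The form has rank one: if [lev x] denotes the coefficient of [eps] in [x],
    then [form x y = 2 * lev x * lev y], a root is an element of level 1 or -1,
    and its reflection is [b |-> b - 2 lev(a) lev(b) a].  Every reflection
    changes the sign of the level, so the corrections made by the successive
    letters of a word alternate in sign, and a word [s] acts as
    [b |-> b - 2 lev(b) r(s)], where [r(s)] is the alternating sum of the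
    letters of [s], each normalized to level 1 ([word_altsum]).

    Let [P] be any basis made of roots and [a = \sum_i n_i P_i] a root.  The
    word [s] represents the reflection in [a] if and only if [r(s)] is the one
    of [a], [- a] that has level 1.  Each letter moves a single coordinate of
    [r(s)] by one, so at least [\sum_i |n_i|] letters are needed
    ([size_altsum]).  This many suffice: as long as the remaining coefficients
    are not all zero, the fact that their weighted sum is 1 or 0, according to
    parity, yields a coefficient of the sign that the next letter reduces
    ([altsum_onto]).  Hence the length is [\sum_i |n_i|] ([refl_length]).

    Finally [k eps + \sum_i m_i sigma_i] has coefficients [m_i] on the
    [sigma_i - eps] and [k + \sum_i m_i] on [eps]; for [k = 1] or [k = -1] the
    sum of their absolute values is the absolute height ([ht_abs]). *)

(** * Coordinates in a basis *)

Lemma lincombD (A : zmodType) n (b : 'I_n -> A) (m m' : {ffun 'I_n -> int}) :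
  lincomb b (m + m') = lincomb b m + lincomb b m'.
Proof.
by rewrite -big_split; apply: eq_bigr => i _; rewrite ffunE mulrzDr.
Qed.

Lemma lincombZ (A : zmodType) n (b : 'I_n -> A) (m : {ffun 'I_n -> int}) z :
  lincomb b [ffun i => m i * z] = lincomb b m *~ z.
Proof.
rewrite /lincomb mulrz_suml; apply: eq_bigr => i _.
by rewrite ffunE mulrzA.
Qed.

Lemma lincomb_delta (A : zmodType) n (b : 'I_n -> A) i z :
  lincomb b [ffun j => if j == i then z else 0] = b i *~ z.
Proof.
rewrite /lincomb (bigD1 i) //= ffunE eqxx big1 ?addr0 // => j /negbTE ji.
by rewrite ffunE ji mulr0z.
Qed.

Lemma lincomb_inj (A : zmodType) n (b : 'I_n -> A) :
  Zbasis b (fun _ => True) -> injective (lincomb b).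
Proof.
move=> [_ gen] m m' mm'.
by have [c [_ uc]] := gen (lincomb b m) I; rewrite -(uc m) // -(uc m').
Qed.

Lemma coordK (A : zmodType) n (b : 'I_n -> A) x :
  Zbasis b (fun _ => True) -> lincomb b (Defs.coord b x) = x.
Proof.
move=> [_ gen]; have [m [xm _]] := gen x I.
by symmetry; apply: (@xgetPex _ _ [set m | x = lincomb b m]%classic); exists m.
Qed.

Lemma lincomb_fcons (A : zmodType) n (x : A) (b : 'I_n -> A) m :
  lincomb (fcons x b) m = x *~ m ord0 + \sum_(i < n) b i *~ m (lift ord0 i).
Proof.
rewrite /lincomb big_ord_recl /fcons unlift_none; congr (_ + _).
by apply: eq_bigr => i _; rewrite liftK.
Qed.

Lemma lincomb_Pi0 (A : zmodType) n (eps : A) (sig : 'I_n -> A)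
    (m : {ffun 'I_n.+1 -> int}) :
  lincomb (Pi0 eps sig) m =
  eps *~ (m ord0 - \sum_(i < n) m (lift ord0 i))
    + \sum_(i < n) sig i *~ m (lift ord0 i).
Proof.
rewrite lincomb_fcons mulrzBr mulrz_sumr -addrA; congr (_ + _).
under eq_bigr do rewrite mulrzBl.
by rewrite sumrB addrC.
Qed.

(** The change of coordinates between the two families is unipotent: it only
    shifts the coefficient of [eps], by the sum of the other ones. *)
Lemma Zbasis_Pi0 (A : zmodType) n (eps : A) (sig : 'I_n -> A) :
  Zbasis (fcons eps sig) (fun _ => True) ->
  Zbasis (Pi0 eps sig) (fun _ => True).
Proof.
move=> basisA; split=> // x _.
pose shift (z : int) (m : {ffun 'I_n.+1 -> int}) : {ffun 'I_n.+1 -> int} :=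
  [ffun i => m i + (if i == ord0 then z else 0)
                   * \sum_(j < n) m (lift ord0 j)].
have shiftE m : lincomb (Pi0 eps sig) m = lincomb (fcons eps sig) (shift (-1) m).
  rewrite lincomb_Pi0 lincomb_fcons ffunE eqxx mulN1r; congr (_ + _).
  by apply: eq_bigr => i _; rewrite ffunE mul0r addr0.
have shiftK z m : shift (- z) (shift z m) = m.
  apply/ffunP => i; rewrite !ffunE.
  have -> : \sum_j shift z m (lift ord0 j) = \sum_j m (lift ord0 j).
    by apply: eq_bigr => j _; rewrite ffunE mul0r addr0.
  by case: eqP => _; ring.
exists (shift 1 (Defs.coord (fcons eps sig) x)); split.
  by rewrite shiftE (shiftK 1) coordK.
move=> m; rewrite shiftE -{1}(coordK x basisA) => /(lincomb_inj basisA) ->.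
exact: (shiftK (-1)).
Qed.

(** * The level and the reflections *)

(** A form whose radical has corank one is determined by the [eps]-coordinate.
    This replaces the rational form and its radical by one integer-valued
    additive map. *)
Lemma level_exists (A : zmodType) nu (form : A -> A -> rat) (eps : A)
    (sig : 'I_nu -> A) :
  biadditive form -> (forall x y, form x y = form y x) ->
  Zbasis (fcons eps sig) (fun _ => True) -> Zbasis sig (radical form) ->
  form eps eps = 2%:R ->
  exists2 lev : {additive A -> int},
    (forall x y, form x y = (2 * lev x * lev y)%:~R) &
    forall x, lev x = Defs.coord (fcons eps sig) x ord0.
Proof.
move=> [DL DR] sym basisA [rad _] ee.
pose lev x := Defs.coord (fcons eps sig) x ord0.
have levD : zmod_morphism lev.
  move=> x y; rewrite /lev.
  have : lincomb (fcons eps sig) (Defs.coord (fcons eps sig) x)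
       = lincomb (fcons eps sig) (Defs.coord (fcons eps sig) (x - y)
                                  + Defs.coord (fcons eps sig) y).
    by rewrite lincombD !coordK // subrK.
  by move=> /(lincomb_inj basisA) ->; rewrite ffunE addrK.
pose levM := GRing.isZmodMorphism.Build A int lev levD.
pose levA : {additive A -> int} := HB.pack lev levM.
exists levA => // x y.
have formB u : zmod_morphism (form u).
  by move=> v w; apply: (addIr (form u w)); rewrite -DR !subrK.
have formE u v : form u v = form u eps *~ lev v.
  pose formM := GRing.isZmodMorphism.Build A rat (form u) (formB u).
  pose formA : {additive A -> rat} := HB.pack (form u) formM.
  rewrite -{1}(coordK v basisA) lincomb_fcons -[form u]/(formA : A -> rat).
  rewrite raddfD raddfMz raddf_sum big1 ?addr0 // => i _.
  by rewrite raddfMz /= sym (rad i) mul0rz.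
rewrite formE sym (formE eps x) ee -!mulrzA -[2%:R]/(2%:~R).
by rewrite -mulrzr -!intrM mulrA.
Qed.

Lemma Rtimes_level (A : zmodType) (form : A -> A -> rat) (eps : A)
    (lev : {additive A -> int}) x :
  (forall x y, form x y = (2 * lev x * lev y)%:~R) ->
  form eps eps = 2%:R -> Rtimes form eps x -> lev x * lev x = 1.
Proof.
move=> formE ee [s rs xs].
have e1 : lev eps * lev eps = 1.
  suff : 2 * lev eps * lev eps = 2 by lia.
  by apply/eqP; rewrite -(eqr_int rat) -formE ee.
have s0 : lev s = 0.
  suff : 2 * lev s * lev eps = 0 by nia.
  by apply/eqP; rewrite -(eqr_int rat) -formE rs.
by case: xs => ->; rewrite raddfD ?raddfN s0 addr0 ?mulrNN.
Qed.

Lemma refl_level (A : zmodType) (form : A -> A -> rat)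
    (lev : {additive A -> int}) a b :
  (forall x y, form x y = (2 * lev x * lev y)%:~R) -> lev a * lev a = 1 ->
  refl form a b = b - a *~ (2 * lev a * lev b).
Proof.
move=> formE aa; rewrite /refl !formE -(mulrA 2 (lev a)) aa mulr1.
rewrite mulrAC divff // mul1r intrKfloor.
by rewrite mulrAC.
Qed.

(** * Words and alternating sums *)

(** The coordinates of [r(s)] when letter [i] stands for a basis root of level
    [e i], so that [e i] times that root has level 1.  The last letter of a word
    acts first, hence it counts positively and signs alternate from there. *)
Fixpoint altsum n (e : 'I_n -> int) (s : seq 'I_n) : {ffun 'I_n -> int} :=
  if s is i :: s' then
    altsum e s' + [ffun j => if j == i then (-1) ^+ size s' * e i else 0]
  else 0.

(** Linearizes the group: the word acts as a transvection or a reflection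
    determined by [altsum] alone.  By [levw] below, the letter [i] put in front
    of [s] sees the level of [b] with sign [(-1) ^+ size s]. *)
Lemma word_altsum (A : zmodType) (form : A -> A -> rat)
    (lev : {additive A -> int}) n (P : 'I_n -> A) s b :
  (forall x y, form x y = (2 * lev x * lev y)%:~R) ->
  (forall i, lev (P i) * lev (P i) = 1) ->
  word form P s b = b - lincomb P (altsum (lev \o P) s) *~ (2 * lev b).
Proof.
move=> formE P1.
have levw t : lev (word form P t b) = (-1) ^+ size t * lev b.
  elim: t => [|i t IH] /=; first by rewrite mul1r.
  rewrite (refl_level _ formE) // raddfB raddfMz IH exprS mulN1r.
  rewrite -mulrzr intz -mulrA mulrCA [X in 2 * X]mulrA P1; ring.
elim: s => [|i s IH] /=.
  have -> : lincomb P 0 = 0 by apply: big1 => i _; rewrite ffunE.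
  by rewrite mul0rz subr0.
rewrite (refl_level _ formE) // levw IH lincombD lincomb_delta mulrzDl opprD.
rewrite addrA -mulrzA; congr (_ - _ *~ _) => /=; ring.
Qed.

Lemma size_altsum n (e : 'I_n -> int) s :
  (forall i, e i * e i = 1) -> (\sum_i `|altsum e s i|%N <= size s)%N.
Proof.
move=> e1; elim: s => [|i s IH]; first by rewrite big1 // => i _; rewrite ffunE.
have step : (\sum_j `|altsum e (i :: s) j| <= \sum_j (`|altsum e s j| + (j == i)))%N.
  apply: leq_sum => j _; rewrite /= !ffunE -signr_odd.
  have ei : e i = 1 \/ e i = -1 by have := e1 i; nia.
  case: eqP => _; last by rewrite addr0 addn0.
  by move: (altsum e s j) => x; case: odd; rewrite ?expr0 ?expr1; case: ei => ->; lia.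
have one : (\sum_(j < n) (j == i) = 1)%N.
  by rewrite (bigD1 i) //= eqxx big1 // => j /negbTE ->.
by apply: leq_trans step _; rewrite big_split /= one addn1.
Qed.

(** Signed units alternate, starting with +1, so they add up to 1 or 0; this
    is the level of [r(s)]. *)
Lemma sum_altsum n (e : 'I_n -> int) s : (forall i, e i * e i = 1) ->
  \sum_i e i * altsum e s i = (odd (size s))%:R.
Proof.
move=> e1; elim: s => [|i s IH] /=.
  by rewrite big1 // => i _; rewrite ffunE mulr0.
under eq_bigr do rewrite ffunE mulrDr.
rewrite big_split /= IH (bigD1 i) //= big1 => [|j /negbTE ji].
  rewrite ffunE eqxx addr0 mulrCA e1 mulr1 -signr_odd.
  by case: odd.
by rewrite ffunE ji mulr0.
Qed.

(** The level condition of [sum_altsum] is the only constraint on [c], and a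
    word without cancellation realizes it.  Induction on the size of [c]: the
    parity of the word to be built is [b], so its first letter carries the sign
    [t], and [c] must have a coefficient that [t] brings closer to zero.  If
    there were none, all terms of [t * \sum_i e i * c i = t * b], which is
    nonnegative, would be nonpositive, and [c] would vanish. *)
Lemma altsum_onto n (e : 'I_n -> int) (c : {ffun 'I_n -> int}) (b : bool) :
  (forall i, e i * e i = 1) -> \sum_i e i * c i = b%:R ->
  exists2 s, size s = (\sum_i `|c i|%N)%N & altsum e s = c.
Proof.
move=> e1; move cN : (\sum_i _)%N => N cb; elim: N c b cN cb => [|N IH] c b cN cb.
  exists [::] => //=; apply/ffunP => i; rewrite ffunE.
  by move: cN; rewrite (bigD1 i) //=; lia.
pose t : int := (-1) ^+ (~~ b).
have [i ti] : exists i, 0 < t * (e i * c i).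
  apply/existsP; apply: contraT; rewrite negb_exists => /forallP neg.
  have ge0 i : true -> 0 <= - (t * (e i * c i)) by rewrite oppr_ge0 leNgt.
  have tb : \sum_i - (t * (e i * c i)) = - b%:R.
    by rewrite sumrN -mulr_sumr cb /t; case: (b).
  have b0 : - b%:R = 0 :> int.
    by apply/eqP; rewrite eq_le -{2}tb sumr_ge0 // andbT; case: (b).
  move: tb; rewrite b0 => /(psumr_eq0P ge0) z.
  suff c0 : (\sum_i `|c i|)%N = 0%N by rewrite c0 in cN.
  apply: big1 => i _; move: (z i isT) (e1 i); rewrite /t.
  by case: (b) => /=; nia.
pose c' : {ffun 'I_n -> int} := c - [ffun j => if j == i then t * e i else 0].
have c'i : c' i = c i - t * e i by rewrite !ffunE eqxx.
have c'E : {in predC1 i, c' =1 c}.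
  by move=> j /negbTE ji; rewrite !ffunE ji subr0.
have ei : e i = 1 \/ e i = -1 by have := e1 i; nia.
have c'N : (\sum_j `|c' j|)%N = N.
  apply: succn_inj; rewrite -cN !(bigD1 i (P := predT)) //= -addSn c'i.
  congr (_ + _)%N; last by apply: eq_bigr => j ji; rewrite c'E.
  move: (c i) ti => ci; rewrite /t.
  by case: (b); rewrite ?expr0 ?expr1; case: ei => ->; lia.
have c'b : \sum_j e j * c' j = (~~ b)%:R.
  have -> : (~~ b)%:R = \sum_j e j * c j - t :> int.
    by rewrite cb /t; case: (b).
  rewrite !(bigD1 i (P := predT)) //= c'i mulrBr mulrCA e1 mulr1 addrAC.
  by congr (_ + _ - _); apply: eq_bigr => j ji; rewrite c'E.
have [s sN sc] := IH c' (~~ b) c'N c'b.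
exists (i :: s); rewrite /= ?sc; first by rewrite sN.
have sb : odd (size s) = ~~ b.
  have := sum_altsum s e1; rewrite sc c'b.
  by case: odd; case: (b).
by rewrite -signr_odd sb -/t subrK.
Qed.

(** * Length of a reflection *)

(** Holds for every basis made of roots.  Multiplying the coordinates by
    [lev a] replaces [a] by the one of [a], [- a] that has level 1, which is
    [r(s)] for every word [s] representing the reflection. *)
Lemma refl_length (A : zmodType) (form : A -> A -> rat)
    (lev : {additive A -> int}) k (P : 'I_k -> A) (n : {ffun 'I_k -> int}) :
  (forall x y, form x y = (2 * lev x * lev y)%:~R) ->
  Zbasis P (fun _ => True) -> (forall i, lev (P i) * lev (P i) = 1) ->
  lev (lincomb P n) * lev (lincomb P n) = 1 ->
  has_length form P (refl form (lincomb P n)) (\sum_(i < k) `|n i|)%N.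
Proof.
move=> formE basisP P1; set a := lincomb P n => a1.
pose c : {ffun 'I_k -> int} := [ffun i => n i * lev a].
have lcE : lincomb P c = a *~ lev a by rewrite lincombZ.
have reflE b : refl form a b = b - lincomb P c *~ (2 * lev b).
  by rewrite (refl_level _ formE) // lcE -mulrzA mulrCA mulrA.
have levc : lev (lincomb P c) = 1 by rewrite lcE raddfMz -mulrzr intz.
have cn : (\sum_i `|c i| = \sum_i `|n i|)%N.
  by apply: eq_bigr => i _; rewrite ffunE; nia.
split=> [|s ws].
  have sum1 : \sum_i (lev \o P) i * c i = true%:R.
    transitivity (lev (lincomb P c)).
      rewrite raddf_sum; apply: eq_bigr => i _.
      by rewrite raddfMz -mulrzr intz.
    exact: levc.
  have [s sc scE] := altsum_onto P1 sum1.
  exists s; first by rewrite sc cn.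
  by move=> b; rewrite (word_altsum _ _ formE) // scE reflE.
suff cE : altsum (lev \o P) s = c by rewrite -cn -cE; exact: size_altsum.
(* An element of level 1 detects the translation part of a word. *)
have := ws (lincomb P c); rewrite reflE (word_altsum _ _ formE) //.
rewrite levc mulr1.
move=> /addrI /oppr_inj; rewrite -!lincombZ => /(lincomb_inj basisP) cE.
apply/ffunP => i; apply: (@mulIf _ 2) => //.
transitivity ([ffun j => altsum (lev \o P) s j * 2] i); first by rewrite ffunE.
by rewrite -cE [LHS]ffunE.
Qed.

(** The exceptional clause of the height, for [k = -1] and
    [mplus m = |mminus m|], is the case where [k + \sum_i m i] is negative
    although [\sum_i m i] is not: there the sum of absolute values is one more,
    rather than one less, than twice [mplus m]. *)
Lemma ht_abs nu (k : int) (m : 'I_nu -> int) : k * k = 1 ->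
  `|(if (k == -1) && (mplus m == `|mminus m|) then k - ht0 m else k + ht0 m)%R|%N
  = (`|(k + \sum_i m i)%R| + \sum_i `|m i|)%N.
Proof.
move=> k1.
have p0 : 0 <= mplus m by apply: sumr_ge0 => i /ltW.
have m0 : mminus m <= 0 by apply: sumr_le0 => i /ltW.
have sumE : \sum_i m i = mplus m + mminus m.
  rewrite /mplus /mminus [in LHS](bigID (fun i => 0 < m i)) /=; congr (_ + _).
  rewrite [LHS](bigID (fun i => m i < 0)) /= [X in _ + X]big1 ?addr0.
    by apply: eq_bigl => i; lia.
  by move=> i; lia.
have absE : (\sum_i `|m i|)%N%:Z = mplus m - mminus m.
  rewrite -[_%:Z]intz sumMz /mplus /mminus.
  rewrite [\sum_(i < nu | 0 < m i) _]big_mkcond.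
  rewrite [\sum_(i < nu | m i < 0) _]big_mkcond.
  by rewrite -sumrB; apply: eq_bigr => i _; case: ifP; case: ifP; lia.
rewrite sumE /ht0; move: (mplus m) (mminus m) (\sum_i _)%N p0 m0 absE => p q S.
move=> p0 q0 SE; have [->|->] : k = 1 \/ k = -1 by nia.
  by case: (leP `|q| p) => /=; lia.
by case: (leP `|q| p); case: (eqVneq p `|q|) => /=; lia.
Qed.

Theorem proposition2p11 (A : zmodType) (nu : nat) (form : A -> A -> rat)
    (eps : A) (sig : 'I_nu -> A)
    (form_biadd : biadditive form)
    (form_sym : forall x y, form x y = form y x)
    (form_psd : forall x, 0 <= form x x)
    (basisA : Zbasis (fcons eps sig) (fun _ => True))
    (basisL : Zbasis sig (radical form))
    (eps2 : form eps eps = 2%:R)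
    (alpha : A) (alphaR : Rtimes form eps alpha) :
  has_length form (Pi0 eps sig) (refl form alpha) `|ht eps sig alpha|%N /\
  (forall n : {ffun 'I_nu.+1 -> int}, alpha = lincomb (Pi0 eps sig) n ->
   has_length form (Pi0 eps sig) (refl form alpha)
     (\sum_(i < nu.+1) `|n i|%N)%N).
Proof.
have [lev formE levE] := level_exists form_biadd form_sym basisA basisL eps2.
have basisP := Zbasis_Pi0 basisA.
have lev1 x : Rtimes form eps x -> lev x * lev x = 1.
  exact: Rtimes_level.
have PiR i : Rtimes form eps (Pi0 eps sig i).
  rewrite /Pi0 /fcons; case: unlift => [j|].
    by exists (sig j); [case: basisL | right; rewrite addrC].
  exists 0; last by left; rewrite addr0.
  by move=> y; rewrite formE raddf0 mulr0 mul0r.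
have main n : alpha = lincomb (Pi0 eps sig) n ->
    has_length form (Pi0 eps sig) (refl form alpha) (\sum_i `|n i|)%N.
  by move=> an; rewrite an; apply: (refl_length formE) => // [i|];
     rewrite -?an; exact: lev1.
split=> //.
pose c := Defs.coord (fcons eps sig) alpha.
(* The coordinates in Pi0, obtained by writing sigma_i = alpha_i + eps. *)
pose n : {ffun 'I_nu.+1 -> int} :=
  [ffun i => c i + if i == ord0 then \sum_j c (lift ord0 j) else 0].
have nE : alpha = lincomb (Pi0 eps sig) n.
  rewrite -[LHS](coordK _ basisA) lincomb_fcons lincomb_Pi0 -/c.
  have -> : \sum_i n (lift ord0 i) = \sum_i c (lift ord0 i).
    by apply: eq_bigr => i _; rewrite ffunE addr0.
  rewrite ffunE eqxx addrK; congr (_ + _).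
  by apply: eq_bigr => i _; rewrite ffunE addr0.
have <- : (\sum_i `|n i| = `|ht eps sig alpha|)%N; last exact: main.
have c1 : c ord0 * c ord0 = 1 by rewrite -levE lev1.
rewrite /ht -/c ht_abs // big_ord_recl ffunE eqxx; congr (_ + _)%N.
by apply: eq_bigr => i _; rewrite ffunE addr0.
Qed.
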